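(* Let $d,K\ge1$, $\Theta=\{1,\dots,K\}$, and for each $\theta\in\Theta$ let $\mathcal D_\theta$ be a probability distribution of $(r,\mathbf a)\in\mathbb R_+\times\mathbb R_+^d$ satisfying the boundedness and continuous-valuation assumptions of the context. Let $\mathbf b\in\mathbb R_+^d$ with $b_{\min}:=\min_i b_i>0$, $P_{\max}=2R_{\max}/b_{\min}$, $\mathcal P=[0,P_{\max}]^d$. A pair $(\mathbf w^\star,\mathbf p^\star)\in\Delta_K\times\mathcal P$ is a saddle point of $\max_{\mathbf w\in\Delta_K}\min_{\mathbf p\in\mathcal P}L(\mathbf w,\mathbf p)$ (and hence attains $V^{\mathrm{mix}}(\mathbf b)$) if and only if: (i) (Envelope support) $\mathrm{supp}(\mathbf w^\star)\subseteq A(\mathbf p^\star)$; (ii) (Feasibility) $H(\mathbf w^\star,\mathbf p^\star)\le\mathbf b$ componentwise; (iii) (Complementarity) $\langle\mathbf p^\star,\mathbf b-H(\mathbf w^\star,\mathbf p^\star)\rangle=0$. Moreover, for such a pair, the mixture $\mathbf w^\star$ together with the threshold acceptance rules $x_\theta(r,\mathbf a)=\mathbf 1\{r>\langle\mathbf p^\star,\mathbf a\rangle\}$ for all $\theta\in\Theta$ is an optimal solution of the maximization problem defining $V^{\mathrm{mix}}(\mathbf b)$, and $V^{\mathrm{mix}}(\mathbf b)=L(\mathbf w^\star,\mathbf p^\star)$.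
   Context: $\mathbb E_\theta$ denotes expectation under $(r,\mathbf a)\sim\mathcal D_\theta$; $(x)_+=\max\{x,0\}$; $\Delta_K$ is the probability simplex in $\mathbb R^K$. Assumptions. Boundedness: there are $R_{\max},A_{\max}>0$ with $0\le r\le R_{\max}$ and $\|\mathbf a\|_\infty\le A_{\max}$ a.s. under every $\mathcal D_\theta$. Continuous valuation: for every $\theta$, if $(r,\mathbf a)\sim\mathcal D_\theta$, the conditional distribution of $r$ given $\mathbf a=\boldsymbol\alpha$ is continuous (has no atoms) for every $\boldsymbol\alpha$ in the support of $\mathbf a$; in particular $\mathbb P_\theta(r=\langle\mathbf p,\mathbf a\rangle)=0$ for every $\mathbf p\in\mathbb R^d$. (In the online problem, the distributions are time-invariant, the pair observed when configuration $\theta$ is selected is an independent draw from $\mathcal D_\theta$, and the total budget over $T$ periods is $\mathbf B=T\mathbf b$.) Definitions. $g_\theta(\mathbf p):=\mathbb E_\theta[(r-\langle\mathbf p,\mathbf a\rangle)_+]$; $h_\theta(\mathbf p):=\mathbb E_\theta[\mathbf a\,\mathbf 1\{r>\langle\mathbf p,\mathbf a\rangle\}]$; $L(\mathbf w,\mathbf p):=\langle\mathbf p,\mathbf b\rangle+\sum_\theta w_\theta g_\theta(\mathbf p)$; $H(\mathbf w,\mathbf p):=\sum_\theta w_\theta h_\theta(\mathbf p)$; $A(\mathbf p):=\arg\max_{\theta\in\Theta}g_\theta(\mathbf p)$; $\mathrm{supp}(\mathbf w)=\{\theta:w_\theta>0\}$. $(\mathbf w^\star,\mathbf p^\star)$ is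 a saddle point if $L(\mathbf w,\mathbf p^\star)\le L(\mathbf w^\star,\mathbf p^\star)\le L(\mathbf w^\star,\mathbf p)$ for all $\mathbf w\in\Delta_K$, $\mathbf p\in\mathcal P$. The mixed fluid value is $V^{\mathrm{mix}}(\mathbf b):=\max_{\mathbf w\in\Delta_K}\max_{\{x_\theta\}}\{\sum_\theta w_\theta\mathbb E_\theta[r\,x_\theta(r,\mathbf a)]:\sum_\theta w_\theta\mathbb E_\theta[\mathbf a\,x_\theta(r,\mathbf a)]\le\mathbf b\}$, the inner maximum being over families of measurable rules $x_\theta:\mathbb R_+\times\mathbb R_+^d\to[0,1]$. *)

(* Defs.v *)
From HB Require Import structures.
From mathcomp Require Import all_boot all_order all_algebra.
From mathcomp Require Import all_classical all_reals all_analysis.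

Set Implicit Arguments.
Unset Strict Implicit.
Unset Printing Implicit Defensive.

Import Order.TTheory GRing.Theory Num.Theory.

Local Open Scope classical_set_scope.
Local Open Scope ring_scope.

Section Defs.
Context {R : realType} {d K : nat}.

(* Observations (r, a).  The sigma-algebra of d.-tuple R is generated by the
   coordinates, i.e. it is the Borel sigma-algebra of R^d. *)
Definition obs := (R * d.-tuple R)%type.

Definition dot (u v : 'I_d -> R) : R := \sum_(i < d) u i * v i.

(* Index sets are nonempty, so the default element of the iterated minimum is
   one of the b i. *)
Definition bmin (hd : (0 < d)%N) (b : 'I_d -> R) : R :=
  \big[Num.min/b (Ordinal hd)]_(i < d) b i.

Definition Pmax (hd : (0 < d)%N) (b : 'I_d -> R) (Rmax : R) : R :=
  2 * Rmax / bmin hd b.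

Definition box (M : R) : set ('I_d -> R) :=
  [set p | forall i, 0 <= p i <= M].

Definition simplex : set ('I_K -> R) :=
  [set w | (forall t, 0 <= w t) /\ \sum_(t < K) w t = 1].

Definition on_orthant (P : probability obs R) : Prop :=
  {ae P, forall z, 0 <= z.1 /\ forall i, 0 <= tnth z.2 i}.

Definition bounded_obs (Rmax Amax : R) (P : probability obs R) : Prop :=
  {ae P, forall z, 0 <= z.1 <= Rmax /\ forall i, `|tnth z.2 i| <= Amax}.

(* The topological support of the law of a; the open boxes around alpha (balls
   of the sup norm) form a neighbourhood base of alpha in R^d. *)
Definition supp_a (P : probability obs R) : set (d.-tuple R) :=
  [set alpha | forall e : R, 0 < e ->
    (0 < P [set z | forall i, (`|tnth z.2 i - tnth alpha i| < e)%R])%E].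

(* k is a regular conditional distribution of r given a:
   P(r \in B, a \in A) = E[k(a, B); a \in A]. *)
Definition cond_dist (P : probability obs R)
    (k : R.-pker (d.-tuple R) ~> R) : Prop :=
  forall (B : set R) (A : set (d.-tuple R)), measurable B -> measurable A ->
    P (B `*` A) = (\int[P]_(z in snd @^-1` A) k z.2 B)%E.

(* Conditional distributions are determined only up to a null set of values of
   a; the condition asks for one version without atoms on the support. *)
Definition continuous_valuation (P : probability obs R) : Prop :=
  exists2 k : R.-pker (d.-tuple R) ~> R, cond_dist P k &
    forall alpha, supp_a P alpha -> forall x : R, k alpha [set x] = 0%E.

(* Real-valued; only used for integrands that are almost surely bounded. *)
Definition Exp (P : probability obs R) (X : obs -> R) : R := fine ('E_P[X])%E.

Definition threshold (p : 'I_d -> R) (z : obs) : R :=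
  (dot p (tnth z.2) < z.1)%R%:R.

Section Problem.
Variables (D : 'I_K -> probability obs R) (b : 'I_d -> R).

Definition g (t : 'I_K) (p : 'I_d -> R) : R :=
  Exp (D t) (fun z => Num.max (z.1 - dot p (tnth z.2)) 0).

Definition h (t : 'I_K) (p : 'I_d -> R) (i : 'I_d) : R :=
  Exp (D t) (fun z => tnth z.2 i * threshold p z).

Definition L (w : 'I_K -> R) (p : 'I_d -> R) : R :=
  dot p b + \sum_(t < K) w t * g t p.

Definition H (w : 'I_K -> R) (p : 'I_d -> R) (i : 'I_d) : R :=
  \sum_(t < K) w t * h t p i.

Definition argmax_g (p : 'I_d -> R) : set 'I_K :=
  [set t | forall t', g t' p <= g t p].

Definition supp (w : 'I_K -> R) : set 'I_K := [set t | 0 < w t].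

Definition saddle_point (Pr : set ('I_d -> R))
    (ws : 'I_K -> R) (ps : 'I_d -> R) : Prop :=
  [/\ simplex ws, Pr ps &
    forall w p, simplex w -> Pr p -> L w ps <= L ws ps /\ L ws ps <= L ws p].

(* Rules are defined on all of R x R^d; every measurable rule on the
   nonnegative orthant, where the laws are carried, extends by 0 to one. *)
Definition rule (x : obs -> R) : Prop :=
  measurable_fun setT x /\ forall z, 0 <= x z <= 1.

Definition mix_feasible (w : 'I_K -> R) (x : 'I_K -> obs -> R) : Prop :=
  [/\ simplex w, forall t, rule (x t) &
    forall i, \sum_(t < K) w t * Exp (D t) (fun z => tnth z.2 i * x t z)
              <= b i].

Definition mix_value (w : 'I_K -> R) (x : 'I_K -> obs -> R) : R :=
  \sum_(t < K) w t * Exp (D t) (fun z => z.1 * x t z).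

Definition mix_optimal (w : 'I_K -> R) (x : 'I_K -> obs -> R) : Prop :=
  mix_feasible w x /\
  forall w' x', mix_feasible w' x' -> mix_value w' x' <= mix_value w x.

(* When r is bounded and b is nonnegative the set of values is bounded and
   nonempty, so this is its least upper bound; that it is attained is the
   content of [mix_optimal]. *)
Definition Vmix : R :=
  sup [set v | exists w x, mix_feasible w x /\ v = mix_value w x].

End Problem.
End Defs.

Arguments obs : clear implicits.

(* Main.v *)
(* L is linear in w, so maximality in w means that w is carried by the maximizers
   of g. In p, the gain (r - <p, a>)_+ is convex with subgradient
   - a 1{r > <p, a>}, so L(w, .) is convex with subgradient b - H(w, .), which
   gives sufficiency of (ii) and (iii). For necessity, H is continuous because
   ties r = <p, a> are null (the conditional laws of r have no atoms), so
   the subgradient inequality along coordinate directions passes to the limit;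
   the upper bounds of the box never bind, since there
   L >= Pmax b_i >= 2 Rmax > Rmax >= L(w, 0). Optimality for the mixed fluid
   problem is weak duality, with equality by complementarity. *)
From HB Require Import structures.
Require Import Defs.
From mathcomp Require Import all_boot all_order all_algebra.
From mathcomp Require Import all_classical all_reals all_analysis.
From mathcomp Require Import measurable_realfun ring lra.

Import Order.TTheory GRing.Theory Num.Theory.
Import numFieldNormedType.Exports.

Local Open Scope classical_set_scope.
Local Open Scope ring_scope.

(** * Disintegration of a joint law along a kernel *)

Section disintegration.
Context d1 d2 (X : measurableType d1) (Y : measurableType d2) (R : realType).
Variables (P : probability (X * Y)%type R) (k : R.-pker Y ~> X).
Local Open Scope ereal_scope.

(** Swapping the coordinates turns these sections into x-sections, to which measurability along a
    finite kernel applies. *)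
Lemma measurable_kernel_ysection (A : set (X * Y)) : measurable A ->
  measurable_fun [set: Y] (fun y => k y (ysection A y) : \bar R).
Proof.
move=> mA.
pose A' : set (Y * X) := [set z | A (z.2, z.1)].
have mA' : measurable A'.
  by rewrite -[A']setTI; exact: (measurable_fun_pair measurable_snd measurable_fst).
have secE y : ysection A y = xsection A' y.
  by apply/funext => x; rewrite /ysection /xsection /= !inE.
under eq_fun do rewrite secE.
by apply: measurable_fun_xsection_finite_kernel; rewrite inE.
Qed.

(** The joint law that draws [y] from the second marginal of [P] and then [x] from [k y];
    integrating a function of [z.2] over [P] avoids forming that marginal. *)
Definition disint (A : set (X * Y)) := \int[P]_z k z.2 (ysection A z.2).

Let disint0 : disint set0 = 0.
Proof.
by apply: integral0_eq => z _; rewrite ysection0 measure0.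
Qed.

Let disint_ge0 A : 0 <= disint A.
Proof. exact: integral_ge0. Qed.

Let disint_sigma_additive : semi_sigma_additive disint.
Proof.
move=> F mF tF mUF; rewrite [X in _ --> X](_ : _ =
  \int[P]_z (\sum_(n <oo) k z.2 (ysection (F n) z.2))); last first.
  apply: eq_integral => z _; rewrite ysection_bigcup.
  apply/esym/cvg_lim => //; apply: measure_semi_sigma_additive.
  - by move=> n; exact: measurable_ysection.
  - exact: trivIset_ysection.
  - by apply: bigcupT_measurable => n; exact: measurable_ysection.
apply/cvg_closeP; split.
  by apply: is_cvg_nneseries => n _ _; exact: integral_ge0.
rewrite closeE// integral_nneseries// => n.
exact: (measurableT_comp (measurable_kernel_ysection _ (mF n)) measurable_snd).
Qed.

HB.instance Definition _ := isMeasure.Build _ _ _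
  disint disint0 disint_ge0 disint_sigma_additive.

(** [P] and the finite measure [disint] agree on measurable rectangles, a pi-system generating the
    product sigma-algebra. *)
Lemma disintegration (A : set (X * Y)) :
  (forall (B : set X) (C : set Y), measurable B -> measurable C ->
     P (B `*` C) = \int[P]_(z in snd @^-1` C) k z.2 B) ->
  measurable A -> P A = \int[P]_z k z.2 (ysection A z.2).
Proof.
move=> PX; pose G := [set B `*` C | B in @measurable _ X & C in @measurable _ Y].
apply: (measure_unique G (fun=> setT) _ _ _ _ P disint).
- exact: measurable_prod_measurableType.
- move=> _ _ [B1 mB1 [C1 mC1 <-]] [B2 mB2 [C2 mC2 <-]].
  exists (B1 `&` B2); first exact: measurableI.
  by exists (C1 `&` C2); [exact: measurableI|rewrite setXI].
- by move=> _; exists setT => //; exists setT => //; rewrite setXTT.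
- by rewrite bigcup_const.
- move=> _ [B mB [C mC <-]]; rewrite [LHS](PX _ _ mB mC) integral_mkcond.
  apply: eq_integral => z _; rewrite patchE.
  have -> : (z \in snd @^-1` C) = (z.2 \in C) by apply/idP/idP; rewrite !inE.
  have [zC|zC] := boolP (z.2 \in C); first by rewrite in_ysectionX.
  by rewrite notin_ysectionX// measure0.
- by move=> _; rewrite /= probability_setT ltry.
Qed.

End disintegration.

(** * The bilinear pairing of prices and consumption *)

Section dot.
Context {R : realType} {d : nat}.

Lemma dotC (u v : 'I_d -> R) : dot u v = dot v u.
Proof. by apply: eq_bigr => i _; rewrite mulrC. Qed.

Lemma dotBr (u v v' : 'I_d -> R) : dot u (fun i => v i - v' i) = dot u v - dot u v'.
Proof. by rewrite /dot -sumrB; apply: eq_bigr => i _; rewrite mulrBr. Qed.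

Lemma dotBl (u u' v : 'I_d -> R) : dot (fun i => u i - u' i) v = dot u v - dot u' v.
Proof. by rewrite dotC dotBr !(dotC v). Qed.

Lemma dot_cvg (q : nat -> 'I_d -> R) (p a : 'I_d -> R) :
  (forall i, q n i @[n --> \oo] --> p i) -> dot (q n) a @[n --> \oo] --> dot p a.
Proof.
move=> qp; rewrite /dot; elim: (index_enum _) => [|i s IH].
  by under eq_fun do rewrite big_nil; rewrite big_nil; exact: cvg_cst.
under eq_fun do rewrite big_cons; rewrite big_cons.
by apply: cvgD => //; apply: cvgMr_tmp.
Qed.

End dot.

(** * Measurability, the support of [a], and ties *)

Section observations.
Context {R : realType} {d : nat}.
Implicit Types (P : probability (obs R d) R) (p q : 'I_d -> R).

Lemma measurable_coord (i : 'I_d) :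
  measurable_fun [set: obs R d] (fun z => tnth z.2 i).
Proof. exact: (measurableT_comp (measurable_tnth i) measurable_snd). Qed.

Lemma measurable_dot p : measurable_fun [set: obs R d] (fun z => dot p (tnth z.2)).
Proof.
by apply: measurable_sum => i; apply: measurable_funM => //; exact: measurable_coord.
Qed.

Lemma measurable_threshold p : measurable_fun [set: obs R d] (threshold p).
Proof.
pose S : set (obs R d) := [set z | dot p (tnth z.2) < z.1].
have mS : measurable S.
  have := measurable_fun_ltr (measurable_dot p) measurable_fst.
  by move=> /(_ measurableT [set true]); rewrite setTI; exact.
rewrite (_ : threshold p = \1_S); first exact: measurable_indic.
by apply/funext => z; rewrite indicE /threshold; congr (nat_of_bool _)%:R;
  apply/idP/idP; rewrite inE.
Qed.

Definition cube (c : 'I_d -> R) (e : R) : set (obs R d) :=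
  [set z | forall i, `|tnth z.2 i - c i| < e].

Lemma measurable_cube c e : measurable (cube c e).
Proof.
rewrite (_ : cube c e =
    \big[setI/setT]_(i < d) [set z | `|tnth z.2 i - c i| < e]).
  apply: bigsetI_measurable => i _.
  have m : measurable_fun [set: obs R d] (fun z => `|tnth z.2 i - c i|).
    apply: measurableT_comp => //.
    by apply: measurable_funB => //; exact: measurable_coord.
  have := measurable_fun_ltr m (measurable_cst e).
  by move=> /(_ measurableT [set true]); rewrite setTI; exact.
rewrite -bigcap_seq; apply/seteqP; split=> z zc i; first by move=> _; exact: zc.
by apply: zc; rewrite /= mem_index_enum.
Qed.

(* The complement of the support is covered by the countably many null cubes
   with rational centre and radius. *)
Lemma ae_supp_a P : {ae P, forall z, supp_a P z.2}.
Proof.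
pose J := ({ffun 'I_d -> rat} * rat)%type.
pose C (j : J) := cube (fun i => ratr (j.1 i)) (ratr j.2).
(* Codes of no cube, or of a cube of positive mass, contribute the empty set. *)
pose F n := if unpickle n is Some j then
  if P (C j) == 0%E then C j else set0 else set0.
have F0 n : P.-negligible (F n).
  rewrite /F; case: unpickle => [j|]; last exact: negligible_set0.
  case: eqP => [Pj|_]; last exact: negligible_set0.
  by apply/negligibleP => //; exact: measurable_cube.
apply: negligibleS (negligible_bigcup F0) => z /= /existsNP[e /not_implyP[e0 nPe]].
(* Radius below [e / 2]: a cube of this radius that contains the point lies within [e] of it, so it
   inherits the null mass. *)
have [e' ] := rat_in_itvoo (divr_gt0 e0 (ltr0n R 2)).
rewrite in_itv/= => /andP[e'0 e'e].
have /choice[q zq] : forall i, exists q : rat, `|tnth z.2 i - ratr q| < ratr e'.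
  move=> i; have [|q] := @rat_in_itvoo R (tnth z.2 i - ratr e') (tnth z.2 i + ratr e').
    by lra.
  by rewrite in_itv/= => zq; exists q; rewrite ltr_norml; lra.
pose j : J := ([ffun i => q i], e').
exists (pickle j) => //=; rewrite /F pickleK.
have zj : C j z by move=> i; rewrite ffunE.
rewrite ifT//; apply/eqP/le_anti; rewrite measure_ge0 andbT leNgt.
apply/negP => Pj; apply: nPe; apply: lt_le_trans Pj _.
apply: le_measure; rewrite ?inE; [exact: measurable_cube|exact: measurable_cube|].
move=> y yj i; have := yj i; have := zj i; rewrite /= !ffunE.
rewrite !ltr_norml => zi yi; lra.
Qed.

Lemma measurable_tie p :
  measurable ([set z | z.1 = dot p (tnth z.2)] : set (obs R d)).
Proof.
have m := measurable_funB measurable_fst (measurable_dot p).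
have := m measurableT [set 0]; rewrite setTI.
set A := _ @^-1` _; set B := [set _ | _]; rewrite (_ : A = B); first exact.
by apply/seteqP; split=> z /=; [exact: subr0_eq|rewrite /A/= => ->; exact: subrr].
Qed.

(** Given [a], a tie pins [r] to the single value [dot p a], so its mass is the integral of an atom
    of [k], which is zero on the support and hence almost surely. *)
Lemma no_tie P p : continuous_valuation P ->
  P [set z | z.1 = dot p (tnth z.2)] = 0%E.
Proof.
move=> [k Pk k0]; have mA := measurable_tie p.
rewrite (disintegration _ _ _ _ _ _ k _ Pk mA).
apply: etrans (integral0 P setT); apply: ge0_ae_eq_integral => //.
- exact: (measurableT_comp (measurable_kernel_ysection _ _ _ _ _ k _ mA)
    measurable_snd).
- have := ae_supp_a P; apply: filterS => z /= zs _.
  rewrite (_ : ysection _ z.2 = [set dot p (tnth z.2)]); first exact: k0.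
  by apply/seteqP; split=> x; rewrite /ysection /= inE.
Qed.

End observations.

(** * Expectations of almost surely bounded functions *)

Section expectation.
Context {R : realType} {d : nat}.
Variable P : probability (obs R d) R.
Implicit Types X Y : obs R d -> R.

(** A class stable under sums, products and positive parts whose members are integrable, so that
    [Exp], a [fine] of an integral, is linear and monotone on it. *)
Definition ess_bounded X := measurable_fun [set: obs R d] X /\
  exists C, {ae P, forall z, `|X z| <= C}.

Lemma ess_boundedW X C : measurable_fun setT X -> (forall z, `|X z| <= C) ->
  ess_bounded X.
Proof. by move=> mX XC; split => //; exists C; exact: aeW. Qed.

Lemma ess_boundedD X Y : ess_bounded X -> ess_bounded Y ->
  ess_bounded (fun z => X z + Y z).
Proof.
move=> [mX [A XA]] [mY [B YB]]; split; first exact: measurable_funD.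
exists (A + B); apply: filterS2 XA YB => z XA YB.
by apply: le_trans (ler_normD _ _) _; exact: lerD.
Qed.

Lemma ess_boundedM X Y : ess_bounded X -> ess_bounded Y ->
  ess_bounded (fun z => X z * Y z).
Proof.
move=> [mX [A XA]] [mY [B YB]]; split; first exact: measurable_funM.
exists (A * B); apply: filterS2 XA YB => z XA YB.
by rewrite normrM; exact: ler_pM.
Qed.

Lemma ess_bounded_cst c : ess_bounded (cst c).
Proof. exact: (@ess_boundedW _ `|c|). Qed.

Lemma ess_boundedZ c X : ess_bounded X -> ess_bounded (fun z => c * X z).
Proof. by apply: ess_boundedM; exact: ess_bounded_cst. Qed.

Lemma ess_boundedB X Y : ess_bounded X -> ess_bounded Y ->
  ess_bounded (fun z => X z - Y z).
Proof.
move=> bX bY; apply: ess_boundedD => //.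
under eq_fun do rewrite -mulN1r; exact: ess_boundedZ.
Qed.

Lemma ess_bounded_sum (I : finType) (F : I -> obs R d -> R) :
  (forall i, ess_bounded (F i)) -> ess_bounded (fun z => \sum_i F i z).
Proof.
move=> bF; elim: (index_enum I) => [|i s IH].
  by under eq_fun do rewrite big_nil; exact: ess_bounded_cst.
by under eq_fun do rewrite big_cons; exact: ess_boundedD.
Qed.

Lemma ess_bounded_pos X : ess_bounded X ->
  ess_bounded (fun z => Num.max (X z) 0).
Proof.
move=> [mX [C XC]]; split; first exact: measurable_maxr.
exists C; apply: filterS XC => z; apply: le_trans.
by case: (leP (X z) 0); rewrite ?normr0.
Qed.

Lemma ess_bounded_integrable X : ess_bounded X ->
  P.-integrable setT (EFin \o X).
Proof.
move=> [mX [C XC]]; apply/integrableP; split; first exact/measurable_EFinP.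
apply: (@le_lt_trans _ _ (\int[P]_z (`|C|)%:E)%E).
  apply: ae_ge0_le_integral => //.
  - by apply: measurableT_comp => //; exact/measurable_EFinP.
  - apply: filterS XC => z XC _; rewrite /= lee_fin.
    exact: le_trans XC (ler_norm _).
by rewrite integral_cst//= probability_setT mule1 ltry.
Qed.

Lemma ExpE X : Exp P X = \int[P]_z X z.
Proof. by rewrite /Exp unlock. Qed.

Lemma ExpD X Y : ess_bounded X -> ess_bounded Y ->
  Exp P (fun z => X z + Y z) = Exp P X + Exp P Y.
Proof. by move=> bX bY; rewrite !ExpE RintegralD//; exact: ess_bounded_integrable. Qed.

Lemma ExpB X Y : ess_bounded X -> ess_bounded Y ->
  Exp P (fun z => X z - Y z) = Exp P X - Exp P Y.
Proof. by move=> bX bY; rewrite !ExpE RintegralB//; exact: ess_bounded_integrable. Qed.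

Lemma ExpZ c X : ess_bounded X -> Exp P (fun z => c * X z) = c * Exp P X.
Proof. by move=> bX; rewrite !ExpE RintegralZl//; exact: ess_bounded_integrable. Qed.

Lemma Exp_cst c : Exp P (cst c) = c.
Proof. by rewrite ExpE Rintegral_cst//= probability_setT mulr1. Qed.

Lemma Exp_sum (I : finType) (F : I -> obs R d -> R) :
  (forall i, ess_bounded (F i)) ->
  Exp P (fun z => \sum_i F i z) = \sum_i Exp P (F i).
Proof.
move=> bF.
(* Additivity needs the partial sums to be bounded, so the induction carries both facts. *)
suff : ess_bounded (fun z => \sum_i F i z) /\
  Exp P (fun z => \sum_i F i z) = \sum_i Exp P (F i) by case.
elim: (index_enum I) => [|i s [bs IH]].
  under eq_fun do rewrite big_nil; rewrite big_nil.
  by split; [exact: ess_bounded_cst|exact: Exp_cst].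
under eq_fun do rewrite big_cons; rewrite big_cons -IH.
by split; [exact: ess_boundedD|exact: ExpD].
Qed.

(** The difference is nonnegative only almost everywhere; it is replaced by its positive part, which
    is nonnegative at every point and has the same integral. *)
Lemma Exp_le X Y : ess_bounded X -> ess_bounded Y ->
  {ae P, forall z, X z <= Y z} -> Exp P X <= Exp P Y.
Proof.
move=> bX bY XY; rewrite -subr_ge0 -ExpB//.
have bYX := ess_boundedB _ _ bY bX.
have bm := ess_bounded_pos _ bYX.
suff -> : Exp P (fun z => Y z - X z) = Exp P (fun z => Num.max (Y z - X z) 0).
  by rewrite ExpE; apply: Rintegral_ge0 => z _; rewrite le_max lexx orbT.
rewrite !ExpE; congr fine; apply: ae_eq_integral => //.
- by apply/measurable_EFinP; exact: bYX.1.
- by apply/measurable_EFinP; exact: bm.1.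
- by apply: filterS XY => z XYz _; rewrite max_l// subr_ge0.
Qed.

Lemma ess_bounded_rule x : rule x -> ess_bounded x.
Proof.
move=> [mx x01]; apply: (@ess_boundedW _ 1) => // z.
by have /andP[x0 x1] := x01 z; rewrite ger0_norm.
Qed.

Lemma rule_threshold (p : 'I_d -> R) : rule (threshold p).
Proof.
split; first exact: measurable_threshold.
by move=> z; rewrite /threshold; case: (_ < _)%R; rewrite ?lexx ?ler01.
Qed.

Variables (Rmax Amax : R).
Hypothesis bP : bounded_obs Rmax Amax P.

Lemma ess_bounded_reward : ess_bounded fst.
Proof.
split => //; exists Rmax; apply: filterS bP => z [/andP[r0 rR] _].
by rewrite ger0_norm.
Qed.

Lemma ess_bounded_coord i : ess_bounded (fun z => tnth z.2 i).
Proof.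
split; first exact: measurable_coord.
by exists Amax; apply: filterS bP => z [_]; exact.
Qed.

Lemma ess_bounded_dot p : ess_bounded (fun z => dot p (tnth z.2)).
Proof.
by apply: ess_bounded_sum => i; apply: ess_boundedZ; exact: ess_bounded_coord.
Qed.

Lemma Exp_dotM p x : ess_bounded x ->
  Exp P (fun z => dot p (tnth z.2) * x z) =
  dot p (fun i => Exp P (fun z => tnth z.2 i * x z)).
Proof.
move=> bx.
have bi i : ess_bounded (fun z => tnth z.2 i * x z).
  by apply: ess_boundedM => //; exact: ess_bounded_coord.
rewrite /dot (_ : (fun _ => _) = fun z => \sum_i p i * (tnth z.2 i * x z)).
  rewrite Exp_sum => [|i]; last exact: ess_boundedZ.
  by apply: eq_bigr => i _; rewrite ExpZ.
by apply/funext => z; rewrite mulr_suml; apply: eq_bigr => i _; rewrite mulrA.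
Qed.

(** Continuity of [h] in the price, by dominated convergence with bound [Amax]. Off the null set of
    ties, [r] is strictly on one side of [dot p a], so the indicator at [q n] is eventually that at
    [p]. *)
Lemma Exp_threshold_cvg (q : nat -> 'I_d -> R) (p : 'I_d -> R) (i : 'I_d) :
  continuous_valuation P -> (forall j, q n j @[n --> \oo] --> p j) ->
  Exp P (fun z => tnth z.2 i * threshold (q n) z) @[n --> \oo] -->
  Exp P (fun z => tnth z.2 i * threshold p z).
Proof.
move=> cP qp.
have bX p' : ess_bounded (fun z => tnth z.2 i * threshold p' z).
  apply: ess_boundedM; first exact: ess_bounded_coord.
  exact/ess_bounded_rule/rule_threshold.
have tie : {ae P, forall z, z.1 != dot p (tnth z.2)}.
  apply: (@negligibleS _ _ _ _ [set z | z.1 = dot p (tnth z.2)]).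
    by move=> z /= /negP; rewrite negbK => /eqP.
  by apply/negligibleP; [exact: measurable_tie|exact: no_tie].
have lim : {ae P, forall z, setT z ->
    (tnth z.2 i * threshold (q n) z)%:E @[n --> \oo] -->
    (tnth z.2 i * threshold p z)%:E}.
  apply: filterS tie => z zp _; apply: cvg_near_cst.
  have qz := dot_cvg _ _ (tnth z.2) qp.
  move: zp; rewrite neq_lt => /orP[zp|pz].
    near=> n; rewrite /threshold (lt_gtF zp) lt_gtF//.
    by near: n; exact: (cvgr_gt _ qz).
  near=> n; rewrite /threshold pz (_ : dot (q n) _ < _)//.
  by near: n; exact: (cvgr_lt _ qz).
have dom : {ae P, forall z n, setT z ->
    (`|(tnth z.2 i * threshold (q n) z)%:E| <= Amax%:E)%E}.
  apply: filterS bP => z [_ /(_ i) zA] n _.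
  rewrite lee_fin normrM; apply: le_trans zA.
  by rewrite ler_piMr// /threshold; case: (_ < _)%R; rewrite ?normr1 ?normr0.
have [_ _ cE] := @dominated_convergence _ _ _ P setT measurableT
  (fun n z => (tnth z.2 i * threshold (q n) z)%:E)
  (fun z => (tnth z.2 i * threshold p z)%:E) (cst Amax%:E)
  (fun n => proj2 (measurable_EFinP _ _) (bX (q n)).1)
  (proj2 (measurable_EFinP _ _) (bX p).1) lim
  (ess_bounded_integrable _ (ess_bounded_cst Amax)) dom.
rewrite ExpE; under eq_fun do rewrite ExpE.
apply: fine_cvg; rewrite fineK//.
exact: integrable_fin_num (ess_bounded_integrable _ (bX p)).
Unshelve. all: by end_near.
Qed.

End expectation.

(** * Subgradients, weak duality and the support condition *)

Section pricing.
Context {R : realType} {d K : nat}.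
Variables (D : 'I_K -> probability (obs R d) R) (b : 'I_d -> R) (Rmax Amax : R).
Hypothesis bD : forall t, bounded_obs Rmax Amax (D t).
Implicit Types (w : 'I_K -> R) (p : 'I_d -> R).

Let bcoord t i : ess_bounded (D t) (fun z => tnth z.2 i).
Proof. exact: ess_bounded_coord (bD t) i. Qed.

Let bdot t p : ess_bounded (D t) (fun z => dot p (tnth z.2)).
Proof. exact: ess_bounded_dot (bD t) p. Qed.

Let bgain t p : ess_bounded (D t) (fun z => z.1 - dot p (tnth z.2)).
Proof. by apply: ess_boundedB => //; exact: ess_bounded_reward (bD t). Qed.

Lemma Exp_gain t p x : rule x ->
  Exp (D t) (fun z => (z.1 - dot p (tnth z.2)) * x z) =
  Exp (D t) (fun z => z.1 * x z) -
  dot p (fun i => Exp (D t) (fun z => tnth z.2 i * x z)).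
Proof.
move=> /(ess_bounded_rule (D t)) bx.
rewrite -(Exp_dotM _ _ _ (bD t)) -?ExpB//.
- by congr Exp; apply/funext => z; rewrite mulrBl.
- by apply: ess_boundedM => //; exact: ess_bounded_reward (bD t).
- exact: ess_boundedM.
Qed.

(** Pointwise [u * x <= max u 0] for [x] between 0 and 1: no rule beats thresholding at the given
    price. *)
Lemma Exp_gain_le t p x : rule x ->
  Exp (D t) (fun z => (z.1 - dot p (tnth z.2)) * x z) <= g D t p.
Proof.
move=> rx; have bx := ess_bounded_rule (D t) _ rx.
apply: Exp_le.
- exact: ess_boundedM.
- exact: ess_bounded_pos.
- apply: aeW => z; have /andP[x0 x1] := rx.2 z.
  case: (leP (z.1 - dot p (tnth z.2)) 0) => u0; first by rewrite mulr_le0_ge0.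
  by rewrite ler_piMr// ltW.
Qed.

Lemma Exp_gain_threshold t p q :
  Exp (D t) (fun z => (z.1 - dot q (tnth z.2)) * threshold p z) =
  Exp (D t) (fun z => z.1 * threshold p z) - dot q (h D t p).
Proof. exact/Exp_gain/rule_threshold. Qed.

Lemma g_threshold t p :
  g D t p = Exp (D t) (fun z => (z.1 - dot p (tnth z.2)) * threshold p z).
Proof.
congr Exp; apply/funext => z; rewrite /threshold -subr_gt0.
by case: ltP; rewrite ?mulr1 ?mulr0.
Qed.

(** The threshold rule of [p] is still a rule at price [q]. Its gain there bounds [g] from below, is
    affine in [q] with slope [- h D t p], and equals [g] at [p]. *)
Lemma g_subgradient t p q : g D t p - dot (fun i => q i - p i) (h D t p) <= g D t q.
Proof.
apply: le_trans (Exp_gain_le t q _ (rule_threshold p)).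
by rewrite g_threshold !Exp_gain_threshold dotBl; lra.
Qed.

Lemma dot_H w p q : dot q (H D w p) = \sum_t w t * dot q (h D t p).
Proof.
rewrite /dot /H; under eq_bigr do rewrite mulr_sumr.
rewrite exchange_big/=; apply: eq_bigr => t _.
by rewrite mulr_sumr; apply: eq_bigr => i _; rewrite mulrCA.
Qed.

Lemma L_subgradient w p q : (forall t, 0 <= w t) ->
  L D b w p + dot (fun i => q i - p i) (fun i => b i - H D w p i) <= L D b w q.
Proof.
move=> w0; rewrite dotBr dot_H.
rewrite dotBl.
suff : \sum_t w t * g D t p - \sum_t w t * dot (fun i => q i - p i) (h D t p)
    <= \sum_t w t * g D t q by rewrite /L; lra.
rewrite -sumrB; apply: ler_sum => t _; rewrite -mulrBr.
by apply: ler_wpM2l => //; exact: g_subgradient.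
Qed.

(** Weak duality: a reward is its net gain, at most [g] on average, plus the price of consumption;
    at nonnegative prices, consumption within [b] costs at most [dot p b]. *)
Lemma mix_value_le_L w x p : (forall i, 0 <= p i) -> mix_feasible D b w x ->
  mix_value D w x <= L D b w p.
Proof.
move=> p0 [[w0 _] rx wxb].
apply: (@le_trans _ _ (\sum_t w t * (g D t p +
    dot p (fun i => Exp (D t) (fun z => tnth z.2 i * x t z))))).
  apply: ler_sum => t _; apply: ler_wpM2l => //.
  by have := Exp_gain_le t p _ (rx t); rewrite Exp_gain//; lra.
under eq_bigr do rewrite mulrDr; rewrite big_split/= addrC lerD2r.
apply: (@le_trans _ _ (dot p (fun i =>
    \sum_t w t * Exp (D t) (fun z => tnth z.2 i * x t z)))).
  rewrite /dot; under [leRHS]eq_bigr do rewrite mulr_sumr.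
  rewrite exchange_big/=; apply: ler_sum => t _; rewrite mulr_sumr.
  by apply: ler_sum => i _; rewrite mulrCA.
by apply: ler_sum => i _; exact: ler_wpM2l.
Qed.

(** Both inequalities of weak duality become equalities: thresholding attains [g], and
    complementarity makes consumption cost exactly [dot p b]. *)
Lemma mix_value_threshold w p : dot p (fun i => b i - H D w p i) = 0 ->
  mix_value D w (fun=> threshold p) = L D b w p.
Proof.
rewrite dotBr => /subr0_eq pb; rewrite /L pb dot_H -big_split/=.
apply: eq_bigr => t _; rewrite -mulrDr g_threshold Exp_gain_threshold.
by rewrite addrC subrK.
Qed.

Lemma argmax_g_supp w p : simplex w ->
  (forall w', simplex w' -> L D b w' p <= L D b w p) <->
  supp w `<=` argmax_g D p.
Proof.
move=> [w0 w1]; split=> [wmax t wt t'|wA w' [w'0 w'1]]; last first.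
  (* Weights summing to one leave some [t] in the support; its value [g D t p] is the maximum and
     separates the two mixtures. *)
  have [t wt] : exists t, supp w t.
    apply: contrapT => /forallNP wN; move: w1; rewrite big1 => [/eqP|t _].
      by rewrite eq_sym oner_eq0.
    by apply/eqP; rewrite eq_le w0 leNgt andbT; apply/negP; exact: wN.
  rewrite /L lerD2l; apply: (@le_trans _ _ (\sum_s w' s * g D t p)).
    by apply: ler_sum => s _; apply: ler_wpM2l => //; exact: wA.
  rewrite -mulr_suml w'1 -w1 mulr_suml; apply: ler_sum => s _.
  have := w0 s; rewrite le_eqVlt => /predU1P[<-|ws]; first by rewrite !mul0r.
  by apply: ler_wpM2l => //; exact: wA.
(* The vertices of the simplex show that every [g D s p] is at most the mean [m]. The nonnegative
   terms [w s * (m - g D s p)] sum to zero, so each vanishes. *)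
pose m := \sum_s w s * g D s p.
have gm s : g D s p <= m.
  have := wmax (fun u => (u == s)%:R); rewrite /L lerD2l.
  rewrite (bigD1 s)//= eqxx mul1r big1 ?addr0; last first.
    by move=> u /negPf ->; rewrite mul0r.
  apply; split=> [u|]; first by case: eqP.
  by rewrite (bigD1 s)//= eqxx big1 ?addr0// => u /negPf ->.
have sum0 : \sum_s w s * (m - g D s p) = 0.
  by under eq_bigr do rewrite mulrBr; rewrite sumrB -mulr_suml w1 mul1r subrr.
have := psumr_eq0P (fun s _ => mulr_ge0 (w0 s) _) sum0.
move=> /(_ (fun s => ltac:(rewrite subr_ge0; exact: gm)) t isT)/eqP.
by rewrite mulf_eq0 gt_eqF//= subr_eq0 => /eqP <-; exact: gm.
Qed.

(** Complementarity reduces the subgradient bound on the increase to the pairing of [q] with the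
    slack, a sum of nonnegative terms. *)
Lemma kkt_L_min w p q : (forall t, 0 <= w t) -> (forall i, 0 <= q i) ->
  (forall i, H D w p i <= b i) -> dot p (fun i => b i - H D w p i) = 0 ->
  L D b w p <= L D b w q.
Proof.
move=> w0 q0 Hb compl; apply: le_trans (L_subgradient w p q w0).
rewrite lerDl dotBl compl subr0.
by apply: sumr_ge0 => i _; rewrite mulr_ge0// subr_ge0.
Qed.

(** * Continuity of [H], first-order conditions and bounds on [L] *)

Hypothesis cD : forall t, continuous_valuation (D t).

Lemma H_cvg w (q : nat -> 'I_d -> R) p i :
  (forall j, q n j @[n --> \oo] --> p j) ->
  H D w (q n) i @[n --> \oo] --> H D w p i.
Proof.
move=> qp; rewrite /H; elim: (index_enum _) => [|t s IH].
  by under eq_fun do rewrite big_nil; rewrite big_nil; exact: cvg_cst.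
under eq_fun do rewrite big_cons; rewrite big_cons.
apply: cvgD => //; apply: cvgMl_tmp.
exact: Exp_threshold_cvg (bD t) _ _ _ (cD t) qp.
Qed.

(* Moving from [p] to [p + (c / n) e_i] cannot decrease [L]; the subgradient at
   the displaced point bounds the increase by [(c / n) (b i - H i)]. *)
Lemma L_min_dir w p i c (S : set ('I_d -> R)) : (forall t, 0 <= w t) ->
  (forall q, S q -> L D b w p <= L D b w q) ->
  (forall n : nat, S (fun j => p j + (j == i)%:R * (c * n.+1%:R^-1))) ->
  0 <= c * (b i - H D w p i).
Proof.
move=> w0 pmin Sq; pose q n j := p j + (j == i)%:R * (c * n.+1%:R^-1).
have qp j : q n j @[n --> \oo] --> p j.
  rewrite -[X in _ --> X]addr0 -[X in _ + X](mulr0 (j == i)%:R).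
  apply: cvgD; first exact: cvg_cst.
  apply: cvgMl_tmp; rewrite -[X in _ --> X](mulr0 c).
  by apply: cvgMl_tmp; exact: cvg_harmonic.
have /cvgMl_tmp-/(_ c) cv : b i - H D w (q n) i @[n --> \oo] --> b i - H D w p i.
  by apply: cvgB; [exact: cvg_cst|exact: H_cvg].
rewrite -(cvg_lim _ cv)//; apply: limr_ge; first by apply/cvg_ex; eexists; exact: cv.
apply: nearW => n; rewrite leNgt; apply/negP => neg.
have := le_trans (L_subgradient w (q n) p w0) (pmin _ (Sq n)).
rewrite gerDl /dot (bigD1 i)//= big1 => [|j /negPf ji]; last first.
  by rewrite /q ji mul0r addr0 subrr mul0r.
rewrite addr0 /q eqxx mul1r opprD addrA subrr sub0r mulNr oppr_le0 leNgt.
apply/negP; rewrite negbK -mulrA [_^-1 * _]mulrC mulrA.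
by rewrite pmulr_llt0 ?invr_gt0.
Qed.

(** At zero price each [g] is a mean reward. Against [L_ge_dot], this bound keeps a minimizing price
    off the upper faces of the box. *)
Lemma L0_le w : simplex w -> L D b w (fun=> 0) <= Rmax.
Proof.
move=> [w0 w1]; rewrite /L {1}/dot big1 => [|i _]; last by rewrite mul0r.
rewrite add0r -[leRHS]mul1r -w1 mulr_suml; apply: ler_sum => t _.
apply: ler_wpM2l => //; rewrite -[leRHS](Exp_cst (D t)); apply: Exp_le.
- exact: ess_bounded_pos.
- exact: ess_bounded_cst.
- apply: filterS (bD t) => z [/andP[r0 rR] _].
  by rewrite /dot big1 ?subr0 => [|i _]; rewrite ?mul0r// max_l.
Qed.

Lemma L_ge_dot w p : (forall t, 0 <= w t) -> dot p b <= L D b w p.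
Proof.
move=> w0; rewrite lerDl; apply: sumr_ge0 => t _; rewrite mulr_ge0//.
rewrite -[leLHS](Exp_cst (D t)); apply: Exp_le.
- exact: ess_bounded_cst.
- exact: ess_bounded_pos.
- by apply: aeW => z; rewrite le_max lexx orbT.
Qed.

End pricing.

(** * Saddle points and the optimality conditions *)

Lemma bmin_le {R : realType} {d : nat} (hd : (0 < d)%N) (b : 'I_d -> R) i :
  bmin hd b <= b i.
Proof. exact: bigmin_le_cond. Qed.


Theorem theorem6 (R : realType) (d K : nat) (hd : (0 < d)%N) (hK : (0 < K)%N)
    (D : 'I_K -> probability (obs R d) R) (b : 'I_d -> R) (Rmax Amax : R)
    (hRmax : 0 < Rmax) (hAmax : 0 < Amax)
    (horth : forall t, on_orthant (D t))
    (hbound : forall t, bounded_obs Rmax Amax (D t))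
    (hcont : forall t, continuous_valuation (D t))
    (hb : forall i, 0 <= b i) (hbmin : 0 < bmin hd b)
    (ws : 'I_K -> R) (ps : 'I_d -> R)
    (hws : simplex ws) (hps : box (Pmax hd b Rmax) ps) :
  (saddle_point D b (box (Pmax hd b Rmax)) ws ps <->
    [/\ supp ws `<=` argmax_g D ps,
        forall i, H D ws ps i <= b i &
        dot ps (fun i => b i - H D ws ps i) = 0]) /\
  (saddle_point D b (box (Pmax hd b Rmax)) ws ps ->
    mix_optimal D b ws (fun _ : 'I_K => threshold ps) /\
    mix_value D ws (fun _ : 'I_K => threshold ps) = Vmix D b /\
    Vmix D b = L D b ws ps).
Proof.
have ws0 := hws.1.
have ps0 i : 0 <= ps i by have /andP[] := hps i.
set M := Pmax hd b Rmax.
have M0 : 0 < M by rewrite /M /Pmax divr_gt0// mulr_gt0.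
have saddleP : saddle_point D b (box M) ws ps ->
    [/\ supp ws `<=` argmax_g D ps,
        forall i, H D ws ps i <= b i &
        dot ps (fun i => b i - H D ws ps i) = 0].
  move=> [_ _ sad].
  have wmax w : simplex w -> L D b w ps <= L D b ws ps.
    by move=> sw; have [] := sad w ps sw hps.
  have pmin p : box M p -> L D b ws ps <= L D b ws p.
    by move=> bp; have [] := sad ws p hws bp.
  (* A coordinate on the upper face costs at least [M * bmin hd b], which the factor 2 in [Pmax]
     puts strictly above [Rmax]. *)
  have ltM i : ps i < M.
    have box0 : box M (fun _ : 'I_d => 0) by move=> j; rewrite lexx ltW.
    have bR := le_trans (L_ge_dot D b Rmax Amax hbound _ ps ws0)
      (le_trans (pmin _ box0) (L0_le D b Rmax Amax hbound _ hws)).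
    rewrite ltNge; apply/negP => Mp.
    suff : 2 * Rmax <= Rmax by move: hRmax; lra.
    apply: le_trans bR; rewrite /dot (bigD1 i)//=.
    apply: ler_wpDr; first by apply: sumr_ge0 => j _; rewrite mulr_ge0.
    have -> : 2 * Rmax = M * bmin hd b by rewrite /M /Pmax divfK// gt_eqF.
    by apply: ler_pM => //; [exact: ltW|exact: ltW|exact: bmin_le].
  (* By convexity of the box, if the full step [c] stays inside, so do the fractions of it that
     [L_min_dir] uses. *)
  have dir i c (c0 : 0 <= ps i + c <= M) : 0 <= c * (b i - H D ws ps i).
    apply: (L_min_dir _ _ _ _ hbound hcont _ _ _ _ _ ws0 pmin) => n j.
    case: eqP => [->|_]; last by rewrite mul0r addr0.
    rewrite mul1r; have /andP[pi0 piM] := hps i.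
    have n0 : (0 : R) < n.+1%:R^-1 by rewrite invr_gt0.
    have n1 : (n.+1%:R^-1 : R) <= 1 by rewrite invf_le1// ler1n.
    have /andP[c0l c0r] := c0; set t := _^-1 in n0 n1 *.
    have -> : ps i + c * t = (1 - t) * ps i + t * (ps i + c) by ring.
    have t1 : 0 <= 1 - t by rewrite subr_ge0.
    rewrite addr_ge0 ?mulr_ge0// ?(ltW n0)//=.
    have -> : M = (1 - t) * M + t * M by ring.
    by apply: lerD; apply: ler_wpM2l => //; exact: ltW.
  (* The step [M - ps i] to the upper face is positive by [ltM], so it can be divided out. *)
  have Hb i : H D ws ps i <= b i.
    have := dir i (M - ps i); rewrite addrC subrK lexx ltW// => /(_ isT).
    by rewrite pmulr_rge0 ?subr_ge0 ?subr_gt0.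
  split=> //; first exact: (argmax_g_supp D b ws ps hws).1.
  (* Each product is nonnegative by feasibility and nonpositive by the step [- ps i] down to the
     zero face. *)
  rewrite /dot big1// => i _; apply/eqP; rewrite eq_le.
  rewrite mulr_ge0 ?subr_ge0// andbT -oppr_ge0 -mulNr; apply: dir.
  by rewrite subrr lexx ltW.
split; last first.
  move=> sad; have [suppA Hb compl] := saddleP sad.
  have val := mix_value_threshold D b Rmax Amax hbound ws ps compl.
  have opt : mix_optimal D b ws (fun=> threshold ps).
    split=> [|w x wx]; first by split=> // t; exact: rule_threshold.
    (* Weak duality bounds the value by [L] at [w] and [ps]; the support condition then passes from
       [w] to [ws]. *)
    rewrite val; apply: le_trans (mix_value_le_L D b _ _ hbound _ _ _ ps0 wx) _.
    by case: wx => sw _ _; exact: (argmax_g_supp D b ws ps hws).2.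
  suff VE : Vmix D b = L D b ws ps by rewrite VE.
  (* [sup] has its usual meaning only on nonempty sets bounded above; the optimal solution supplies
     both the element and the bound. *)
  rewrite -val; apply/le_anti/andP; split.
    apply: ge_sup.
      by eexists; exists ws, (fun=> threshold ps); split; [exact: opt.1|].
    by move=> _ [w [x [wx ->]]]; exact: opt.2.
  apply: ub_le_sup; last by exists ws, (fun=> threshold ps); split=> //; case: opt.
  by exists (mix_value D ws (fun=> threshold ps)) => _ [w [x [wx ->]]]; exact: opt.2.
split=> [|[suppA Hb compl]]; first exact: saddleP.
split=> // w p sw bp; split.
  exact: (argmax_g_supp D b ws ps hws).2.
apply: (kkt_L_min _ _ _ _ hbound) => // i; by have /andP[] := bp i.
Qed.
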